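(* Let $S$ be a sigmoidal nonlinearity and, for $\delta\neq 0$, let $B_\delta(u):=S(u+\delta)-S(u-\delta)-2S(\delta)$. Consider the interconnection with input $u$, output $y$ and parameters $\alpha,\beta,\gamma\in\mathbb{R}$ whose static behavior is $-y+S(B_\delta(u+\gamma y/2)+y+\alpha+\beta y)=0$. For $\delta>0$ and sufficiently small, the static behavior $-y+S(B_\delta(u)+y)=0$ of this interconnection with $\alpha=\beta=\gamma=0$ is strongly equivalent to the winged cusp, i.e. the mapping $(y,u)\mapsto -y+S(B_\delta(u)+y)$ is strongly equivalent near the origin to the mapping $g_{wcusp}(y,u):=-y^3-u^2$.
   Context: Notation: $S^{(n)}$ denotes the $n$-th derivative of a smooth function $S$ of one real variable; subscripts denote partial derivatives. A static behavior is the set of pairs $(y,u)\in\mathbb{R}\times\mathbb{R}$ satisfying $g(y,u)=0$ for a smooth function $g$; it is identified with the mapping $g$. The variable $y$ is the output and $u$ is the input (bifurcation parameter). Sigmoidal nonlinearity: a smooth function $S:\mathbb{R}\to\mathbb{R}$ (with associated sigmoidal static behavior $-y+S(u)=0$) such that (a) $S(-u)=-S(u)$ for all $u\in\mathbb{R}$; (b) $S^{(1)}(u)>0$ for all $u\in\mathbb{R}$; (c) $\lim_{u\to\pm\infty}S^{(1)}(u)=0$; (d) for all $n\in\mathbb{N}$, $S^{(2n+1)}(0)\neq 0$, with $S^{(1)}(0)=1$; (e) for all $n\in\mathbb{N}$, $\mathrm{sgn}(S^{(2n)}(u))=-\mathrm{sgn}(u)$ for all $u\neq 0$. Equivalence: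 two smooth mappings $h,g:\mathbb{R}\times\mathbb{R}\to\mathbb{R}$ are equivalent near the origin if there exist smooth functions $Y(y,u)$, $U(u)$, $Q(y,u)$, with $Y(0,0)=U(0)=0$ and $Y_y(y,u)>0$, $U_u(u)>0$, $Q(y,u)>0$, such that $h(y,u)=Q(y,u)\,g(Y(y,u),U(u))$ near the origin. They are strongly equivalent if this holds with $U(u)=u$.
   Formalization: Condition (e) of a sigmoidal nonlinearity is required only for n=1, i.e. sgn S''(u) = -sgn(u) for u≠0; as printed, for all n, it contradicts conditions (a) and (b) (n=0 alone, or n=1 and n=2 together), so no such S would exist. *)

(* Defs.v *)
From Stdlib Require Import Reals.
From Coquelicot Require Import Coquelicot.

Open Scope R_scope.

Definition smooth (f : R -> R) : Prop :=
  forall (n : nat) (x : R), ex_derive_n f n x.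

(* [ex_diff_n f n x y]: the mixed partial derivatives of [f] up to order [n]
   exist and are continuous at [(x, y)]. *)
Definition smooth2 (f : R -> R -> R) : Prop :=
  forall (n : nat) (x y : R), ex_diff_n f n x y.

(* [sig_sign] is the sign condition sgn (S^(2n) u) = - sgn u (u <> 0) for n = 1
   only.  Imposed for every n >= 1 it is unsatisfiable: if S'' and S'''' are both
   negative on (0, oo), then S'' vanishes at 0, is concave and negative there,
   hence is bounded away from 0 at infinity, so S' becomes negative, against
   [sig_pos]; for n = 0 it contradicts [sig_odd] and [sig_pos].  The condition
   kept here is weaker and satisfiable (the arctangent is an instance). *)
Record sigmoidal (S : R -> R) : Prop := {
  sig_smooth : smooth S;
  sig_odd : forall u : R, S (- u) = - S u;
  sig_pos : forall u : R, 0 < Derive_n S 1 u;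
  sig_lim_p : is_lim (Derive_n S 1) p_infty 0;
  sig_lim_m : is_lim (Derive_n S 1) m_infty 0;
  sig_odd_derivatives : forall n : nat, Derive_n S (2 * n + 1) 0 <> 0;
  sig_slope : Derive_n S 1 0 = 1;
  sig_sign : forall u : R, u <> 0 -> sign (Derive_n S 2 u) = - sign u
}.

(* In all mappings R x R -> R the first argument is the output y and the second
   one the input u.  Only the identity between [h] and [g] is local: [Y], [U]
   and [Q] are smooth, with the stated signs, on their whole domains. *)
Definition equivalence_by (h g Y : R -> R -> R) (U : R -> R) (Q : R -> R -> R)
    : Prop :=
  smooth2 Y /\ smooth U /\ smooth2 Q /\
  Y 0 0 = 0 /\ U 0 = 0 /\
  (forall y u : R, 0 < Derive (fun z : R => Y z u) y) /\
  (forall u : R, 0 < Derive U u) /\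
  (forall y u : R, 0 < Q y u) /\
  locally_2d (fun y u : R => h y u = Q y u * g (Y y u) (U u)) 0 0.

Definition equivalent (h g : R -> R -> R) : Prop :=
  smooth2 h /\ smooth2 g /\
  exists (Y : R -> R -> R) (U : R -> R) (Q : R -> R -> R),
    equivalence_by h g Y U Q.

Definition strongly_equivalent (h g : R -> R -> R) : Prop :=
  smooth2 h /\ smooth2 g /\
  exists (Y : R -> R -> R) (Q : R -> R -> R),
    equivalence_by h g Y (fun u : R => u) Q.

Definition bump (S : R -> R) (delta u : R) : R :=
  S (u + delta) - S (u - delta) - 2 * S delta.

Definition interconnection (S : R -> R) (delta alpha beta gamma : R)
    (y u : R) : R :=
  - y + S (bump S delta (u + gamma * y / 2) + y + alpha + beta * y).

Definition g_wcusp (y u : R) : R := - y ^ 3 - u ^ 2.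

(* Main.v *)
Require Import Defs.
From Stdlib Require Import Reals Arith Lra Lia FunctionalExtensionality.
From Coquelicot Require Import Coquelicot.

Open Scope R_scope.

(** With [w = B u + y], where [B] is the bump, the mapping is [B u - (w - S w)].
    By Hadamard's lemma [w - S w = w^3 c(w)] and [B u = - u^2 b(u)] with [b] and
    [c] smooth, and the sign condition on [S''] makes them positive everywhere.
    Hence the mapping is [b(u) (- Y^3 - u^2)] with [Y = w (c(w) / b(u))^(1/3)];
    this identity is global and holds for every [delta > 0]. *)

(** * Smooth functions of one variable *)

(** By induction every iterated derivative stays in the class [P], hence can be differentiated once
    more. Smoothness then follows from a class closed under differentiation, with no formula for the
    higher derivatives. *)
Lemma smooth_coind (P : (R -> R) -> Prop) :
  (forall f, P f -> exists g, P g /\ forall x, is_derive f x (g x)) ->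
  forall f, P f -> smooth f.
Proof.
  intros HP f Hf.
  assert (HD : forall n, P (Derive_n f n)).
  { induction n as [|n IH]; [exact Hf|].
    destruct (HP _ IH) as (g & Pg & Hg).
    replace (Derive_n f (S n)) with g; [exact Pg|].
    extensionality x. symmetry. apply is_derive_unique, Hg. }
  intros [|n] x; [exact I|].
  destruct (HP _ (HD n)) as (g & _ & Hg).
  exists (g x). apply Hg.
Qed.

Lemma smooth_is_derive f x : smooth f -> is_derive f x (Derive f x).
Proof. intros Hf. apply Derive_correct, (Hf 1%nat x). Qed.

Lemma smooth_Derive_n f k : smooth f -> smooth (Derive_n f k).
Proof.
  intros Hf [|n] x; [exact I|]. simpl.
  apply ex_derive_ext with (Derive_n f (n + k)).
  - intros t. symmetry. apply Derive_n_comp.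
  - apply (Hf (S (n + k))).
Qed.

Lemma smooth_Derive f : smooth f -> smooth (Derive f).
Proof. apply (smooth_Derive_n f 1). Qed.

Lemma smooth_continuity_pt f x : smooth f -> continuity_pt f x.
Proof.
  intros Hf. apply continuity_pt_filterlim, @ex_derive_continuous.
  exists (Derive f x). now apply smooth_is_derive.
Qed.

Lemma smooth_minus f g : smooth f -> smooth g -> smooth (fun x => f x - g x).
Proof.
  intros Hf Hg n x.
  apply ex_derive_n_minus; apply filter_forall; auto.
Qed.

Lemma smooth_shift f b : smooth f -> smooth (fun x => f (x + b)).
Proof. intros Hf n x. apply ex_derive_n_comp_trans, Hf. Qed.

Lemma smooth_const c : smooth (fun _ => c).
Proof.
  apply (smooth_coind (fun f => exists c, f = fun _ => c)); [|eauto].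
  intros f [d ->]. exists (fun _ => 0). split; [eauto|].
  intros x. apply @is_derive_const.
Qed.

Lemma smooth_id : smooth (fun x => x).
Proof.
  apply (smooth_coind (fun f => f = (fun x => x) \/ exists c, f = fun _ => c));
    [|auto].
  intros f [->|[c ->]].
  - exists (fun _ => 1). split; [eauto|]. intros x. apply @is_derive_id.
  - exists (fun _ => 0). split; [eauto|]. intros x. apply @is_derive_const.
Qed.

(** * Hadamard's lemma *)

(** For [f 0 = 0], the case [k = 0] applied to the derivative of [f] is the Hadamard quotient
    [f x / x], extended smoothly to the origin. The weight [t ^ k] makes the family closed under
    differentiation in [x]. *)
Definition moment (f : R -> R) (k : nat) (x : R) : R :=
  RInt (fun t => t ^ k * f (t * x)) 0 1.

(** Differentiation under the integral sign: the inner factor [t] of [f (t * x)] comes out and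
    raises the weight by one. *)
Lemma is_derive_moment f k x :
  smooth f -> is_derive (moment f k) x (moment (Derive f) (S k) x).
Proof.
  intros Hf.
  assert (Hd : forall t z,
    is_derive (fun z => t ^ k * f (t * z)) z (t ^ S k * Derive f (t * z))).
  { intros t z. auto_derive.
    - exists (Derive f (t * z)). now apply smooth_is_derive.
    - change (Derive (fun y => f y)) with (Derive f). simpl. ring. }
  replace (moment (Derive f) (S k) x) with
    (RInt (fun t => Derive (fun z => t ^ k * f (t * z)) x) 0 1).
  2:{ apply RInt_ext. intros t _. apply is_derive_unique, Hd. }
  apply (is_derive_RInt_param (fun z t => t ^ k * f (t * z)) 0 1 x).
  - apply filter_forall. intros z t _. exists (t ^ S k * Derive f (t * z)). apply Hd.
  - intros t _.
    apply continuity_2d_pt_ext with (fun z t => t ^ S k * Derive f (t * z)).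
    { intros z s. symmetry. apply is_derive_unique, Hd. }
    apply continuity_2d_pt_mult.
    + apply (continuity_1d_2d_pt_comp (fun s => s ^ S k) (fun _ s => s)).
      * apply derivable_continuous_pt, derivable_pt_pow.
      * apply continuity_2d_pt_id2.
    + apply (continuity_1d_2d_pt_comp (Derive f) (fun z s => s * z)).
      * apply smooth_continuity_pt. now apply smooth_Derive.
      * apply continuity_2d_pt_mult;
          [apply continuity_2d_pt_id2|apply continuity_2d_pt_id1].
  - apply filter_forall. intros z. apply @ex_RInt_continuous. intros t _.
    apply @ex_derive_continuous. auto_derive.
    exists (Derive f (t * z)). now apply smooth_is_derive.
Qed.

Lemma smooth_moment f k : smooth f -> smooth (moment f k).
Proof.
  intros Hf.
  apply (smooth_coind (fun h => exists f k, smooth f /\ h = moment f k)); [|eauto].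
  intros h (f' & k' & Hf' & ->).
  exists (moment (Derive f') (S k')). split.
  - exists (Derive f'), (S k'). split; [now apply smooth_Derive|reflexivity].
  - intros x. now apply is_derive_moment.
Qed.

Lemma Derive_n_moment f k n x :
  smooth f -> Derive_n (moment f k) n x = moment (Derive_n f n) (n + k) x.
Proof.
  intros Hf. revert x. induction n as [|n IH]; intros x; [reflexivity|].
  simpl. rewrite (Derive_ext _ _ _ IH).
  apply is_derive_unique, is_derive_moment. now apply smooth_Derive_n.
Qed.

Lemma moment_0 f k : moment f k 0 = f 0 / INR (S k).
Proof.
  apply is_RInt_unique.
  apply (is_RInt_ext (fun t => scal (f 0) (t ^ k))).
  { intros t _. rewrite Rmult_0_r. unfold scal; simpl. unfold mult; simpl. ring. }
  replace (f 0 / INR (S k)) with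
    (scal (f 0) (1 ^ S k / INR (S k) - 0 ^ S k / INR (S k))).
  - apply @is_RInt_scal, is_RInt_pow.
  - unfold scal; simpl scal. unfold mult. cbn -[INR pow].
    rewrite pow1, pow_i by lia. unfold Rdiv. ring.
Qed.

(** The fundamental theorem of calculus for [t |-> f (t * x)] on [[0, 1]]. *)
Lemma hadamard f x : smooth f -> f 0 = 0 -> f x = x * moment (Derive f) 0 x.
Proof.
  intros Hf H0.
  assert (H : is_RInt (fun t => x * Derive f (t * x)) 0 1 (f x)).
  { replace (f x) with (minus (f (1 * x)) (f (0 * x))).
    2:{ rewrite Rmult_1_l, Rmult_0_l, H0. unfold minus, plus, opp; simpl. ring. }
    apply (is_RInt_derive (fun t => f (t * x)) (fun t => x * Derive f (t * x))).
    - intros t _. auto_derive.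
      + exists (Derive f (t * x)). now apply smooth_is_derive.
      + change (Derive (fun y => f y)) with (Derive f). ring.
    - intros t _. apply @ex_derive_continuous. auto_derive.
      eexists. apply smooth_is_derive. now apply smooth_Derive. }
  rewrite <- (is_RInt_unique _ _ _ _ H). unfold moment.
  assert (Hex : ex_RInt (fun t => t ^ 0 * Derive f (t * x)) 0 1).
  { apply @ex_RInt_continuous. intros t _. apply @ex_derive_continuous. auto_derive.
    eexists. apply smooth_is_derive. now apply smooth_Derive. }
  change (x * RInt (fun t => t ^ 0 * Derive f (t * x)) 0 1) with
    (scal x (RInt (fun t => t ^ 0 * Derive f (t * x)) 0 1)).
  rewrite <- RInt_scal by exact Hex.
  apply RInt_ext. intros t _. unfold scal; simpl. unfold mult; simpl. ring.
Qed.

(** Each step divides by [x] once. The [k]-th derivative of the Hadamard quotient at 0 is that of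
    order [k + 1] of [f] divided by [k + 1], so the order of vanishing drops by one and the
    denominators accumulate to [n!]. The value [g 0] is recorded because the factorization says
    nothing about it when [n > 0]. *)
Lemma smooth_factor n f :
  smooth f -> (forall k, (k < n)%nat -> Derive_n f k 0 = 0) ->
  exists g, smooth g /\ (forall x, f x = x ^ n * g x) /\
    g 0 = Derive_n f n 0 / INR (fact n).
Proof.
  revert f. induction n as [|n IH]; intros f Hf H0.
  - exists f. repeat split; [exact Hf|intros; simpl; ring|simpl; field].
  - assert (HD : forall k,
      Derive_n (moment (Derive f) 0) k 0 = Derive_n f (S k) 0 / INR (S k)).
    { intros k. rewrite Derive_n_moment by now apply smooth_Derive.
      rewrite moment_0, (Derive_n_comp f k 1).
      now rewrite Nat.add_0_r, Nat.add_1_r. }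
    destruct (IH (moment (Derive f) 0)) as (g & Hg & Hfg & Hg0).
    + apply smooth_moment. now apply smooth_Derive.
    + intros k Hk. rewrite HD, H0 by lia. unfold Rdiv. ring.
    + exists g. split; [exact Hg|split].
      * intros x. rewrite (hadamard f x Hf (H0 0%nat ltac:(lia))), Hfg. simpl. ring.
      * rewrite Hg0, HD, fact_simpl, mult_INR. field.
        split; [apply INR_fact_neq_0|now apply not_0_INR].
Qed.

(** * Smooth functions of two variables *)

(** This class is closed under both partial derivatives, so that smoothness of its
    members follows by induction on the order alone. *)
Inductive smooth_expr : (R -> R -> R) -> Prop :=
| expr_fst : smooth_expr (fun y _ => y)
| expr_snd : smooth_expr (fun _ u => u)
| expr_const c : smooth_expr (fun _ _ => c)
| expr_plus f g :
    smooth_expr f -> smooth_expr g -> smooth_expr (fun y u => f y u + g y u)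
| expr_mult f g :
    smooth_expr f -> smooth_expr g -> smooth_expr (fun y u => f y u * g y u)
| expr_comp F f :
    smooth F -> smooth_expr f -> smooth_expr (fun y u => F (f y u))
| expr_Rpower a f :
    (forall y u, 0 < f y u) -> smooth_expr f ->
    smooth_expr (fun y u => Rpower (f y u) a).

Lemma is_derive_Rpower a x :
  0 < x -> is_derive (fun z => Rpower z a) x (a * Rpower x (a - 1)).
Proof. intros Hx. apply is_derive_Reals. now apply derivable_pt_lim_power. Qed.

Lemma smooth_expr_continuous f x y : smooth_expr f -> continuity_2d_pt f x y.
Proof.
  intros Hf. revert x y.
  induction Hf as [| |c|f g _ IHf _ IHg|f g _ IHf _ IHg|F f HF _ IH|a f Hpos _ IH];
    intros x y.
  - apply continuity_2d_pt_id1.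
  - apply continuity_2d_pt_id2.
  - apply continuity_2d_pt_const.
  - now apply continuity_2d_pt_plus.
  - now apply continuity_2d_pt_mult.
  - apply continuity_1d_2d_pt_comp; [now apply smooth_continuity_pt|apply IH].
  - apply (continuity_1d_2d_pt_comp (fun z => Rpower z a)); [|apply IH].
    apply continuity_pt_filterlim.
    apply (@ex_derive_continuous _ R_NormedModule (fun z => Rpower z a)).
    eexists. now apply is_derive_Rpower.
Qed.

Lemma smooth_expr_partials f :
  smooth_expr f ->
  exists f1 f2, smooth_expr f1 /\ smooth_expr f2 /\
    forall y u, is_derive (fun z => f z u) y (f1 y u) /\
                is_derive (fun z => f y z) u (f2 y u).
Proof.
  intros Hf.
  induction Hf as [| |c|f g Hf (f1 & f2 & Hf1 & Hf2 & Df) Hg (g1 & g2 & Hg1 & Hg2 & Dg)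
    |f g Hf (f1 & f2 & Hf1 & Hf2 & Df) Hg (g1 & g2 & Hg1 & Hg2 & Dg)
    |F f HF Hf (f1 & f2 & Hf1 & Hf2 & Df)
    |a f Hpos Hf (f1 & f2 & Hf1 & Hf2 & Df)].
  - exists (fun _ _ => 1), (fun _ _ => 0). do 2 (split; [constructor|]).
    intros y u. split; [apply @is_derive_id|apply @is_derive_const].
  - exists (fun _ _ => 0), (fun _ _ => 1). do 2 (split; [constructor|]).
    intros y u. split; [apply @is_derive_const|apply @is_derive_id].
  - exists (fun _ _ => 0), (fun _ _ => 0). do 2 (split; [constructor|]).
    intros y u. split; apply @is_derive_const.
  - exists (fun y u => f1 y u + g1 y u), (fun y u => f2 y u + g2 y u).
    do 2 (split; [now constructor|]).
    intros y u. destruct (Df y u), (Dg y u). split.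
    + now apply (is_derive_plus (fun z => f z u) (fun z => g z u)).
    + now apply (is_derive_plus (f y) (g y)).
  - exists (fun y u => f1 y u * g y u + f y u * g1 y u),
      (fun y u => f2 y u * g y u + f y u * g2 y u).
    do 2 (split; [now repeat constructor|]).
    intros y u. destruct (Df y u), (Dg y u). split.
    + apply (is_derive_mult (fun z => f z u) (fun z => g z u)); auto.
      intros; apply Rmult_comm.
    + apply (is_derive_mult (f y) (g y)); auto. intros; apply Rmult_comm.
  - exists (fun y u => f1 y u * Derive F (f y u)),
      (fun y u => f2 y u * Derive F (f y u)).
    do 2 (split; [now repeat constructor; auto; apply smooth_Derive|]).
    intros y u. destruct (Df y u).
    split; [apply (is_derive_comp F (fun z => f z u))|apply (is_derive_comp F (f y))];
      auto; now apply smooth_is_derive.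
  (* The exponent drops by one over the same positive base, so the class is not left. *)
  - exists (fun y u => f1 y u * (a * Rpower (f y u) (a - 1))),
      (fun y u => f2 y u * (a * Rpower (f y u) (a - 1))).
    do 2 (split; [now repeat constructor|]).
    intros y u. destruct (Df y u).
    split; [apply (is_derive_comp (fun z => Rpower z a) (fun z => f z u))
      |apply (is_derive_comp (fun z => Rpower z a) (f y))];
      auto; now apply is_derive_Rpower.
Qed.

Lemma smooth_expr_smooth2 f : smooth_expr f -> smooth2 f.
Proof.
  intros Hf n. revert f Hf. induction n as [|n IH]; intros f Hf x y.
  - split; [now apply smooth_expr_continuous|exact I].
  - destruct (smooth_expr_partials f Hf) as (f1 & f2 & Hf1 & Hf2 & Df).
    split; [now apply smooth_expr_continuous|].
    split; [exists (f1 x y); apply Df|].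
    split; [exists (f2 x y); apply Df|].
    split.
    + replace (fun u v => Derive (fun z => f z v) u) with f1; [now apply IH|].
      extensionality u. extensionality v. symmetry. apply is_derive_unique, Df.
    + replace (fun u v => Derive (fun z => f u z) v) with f2; [now apply IH|].
      extensionality u. extensionality v. symmetry. apply is_derive_unique, Df.
Qed.

Lemma smooth_expr_comp1 F : smooth F -> smooth_expr (fun _ u => F u).
Proof. intros HF. apply (expr_comp F (fun _ u => u)); [exact HF|constructor]. Qed.

(** * Signs *)

Lemma MVT_smooth f a b :
  smooth f -> a < b ->
  exists c, f b - f a = Derive f c * (b - a) /\ a < c < b.
Proof.
  intros Hf Hab. apply MVT_cor2; [exact Hab|].
  intros c _. apply is_derive_Reals. now apply smooth_is_derive.
Qed.

(** A negative value at 0 would persist, with tolerance [- f 0], at a nearby point [d / 2]. This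
    carries the sign of a factor to the origin, where a factorization does not determine it. *)
Lemma continuity_pt_nonneg f :
  continuity_pt f 0 -> (forall x, x <> 0 -> 0 < f x) -> 0 <= f 0.
Proof.
  intros Hc Hpos. destruct (Rle_or_lt 0 (f 0)) as [|Hneg]; [assumption|exfalso].
  destruct (Hc (- f 0) ltac:(lra)) as (d & Hd & H).
  assert (H1 : Rabs (f (d / 2) - f 0) < - f 0).
  { apply H. split; [split; [exact I|lra]|].
    simpl. unfold Rdist. rewrite Rminus_0_r, Rabs_pos_eq; lra. }
  specialize (Hpos (d / 2) ltac:(lra)).
  rewrite Rabs_pos_eq in H1; lra.
Qed.

Section Sigmoidal.

Variable S : R -> R.
Hypothesis hS : sigmoidal S.

Let hsm : smooth S := sig_smooth S hS.

(** Differentiating [S (- u) = - S u] [n] times puts a factor [(-1) ^ n] on the left; it moves to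
    the other side because its square is 1. *)
Lemma sigmoidal_Derive_n_opp n x :
  Derive_n S n (- x) = (-1) ^ (n + 1) * Derive_n S n x.
Proof.
  assert (H : Derive_n (fun y => S (- y)) n x = (-1) ^ n * Derive_n S n (- x)).
  { apply Derive_n_comp_opp, filter_forall. intros y k _. apply hsm. }
  rewrite (Derive_n_ext _ _ n x (sig_odd S hS)), Derive_n_opp in H.
  rewrite pow_add, Rmult_comm, <- Rmult_assoc, (Rmult_comm _ (_ ^ n)).
  replace (Derive_n S n (- x)) with
    ((-1) ^ n * ((-1) ^ n * Derive_n S n (- x))).
  - rewrite <- H. simpl. ring.
  - rewrite <- Rmult_assoc, <- pow_add.
    replace (n + n)%nat with (2 * n)%nat by lia. rewrite pow_1_even. ring.
Qed.

Lemma sigmoidal_Derive_even x : Derive S (- x) = Derive S x.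
Proof.
  change (Derive_n S 1 (- x) = Derive_n S 1 x).
  rewrite sigmoidal_Derive_n_opp. simpl. ring.
Qed.

Lemma sigmoidal_0 : S 0 = 0.
Proof. pose proof (sig_odd S hS 0) as H. rewrite Ropp_0 in H. lra. Qed.

Lemma sigmoidal_Derive2_0 : Derive_n S 2 0 = 0.
Proof.
  pose proof (sigmoidal_Derive_n_opp 2 0) as H.
  rewrite Ropp_0 in H. simpl in *. lra.
Qed.

Lemma sigmoidal_Derive2_neg x : 0 < x -> Derive_n S 2 x < 0.
Proof.
  intros Hx. pose proof (sig_sign S hS x ltac:(lra)) as H.
  rewrite (sign_eq_1 x Hx) in H.
  destruct (Rtotal_order (Derive_n S 2 x) 0) as [Hl|[He|Hg]]; [exact Hl| |].
  - rewrite He, sign_0 in H. lra.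
  - rewrite sign_eq_1 in H by exact Hg. lra.
Qed.

(** The mean value point is interior, hence positive, so [a = 0] is allowed although the second
    derivative vanishes there. *)
Lemma sigmoidal_Derive_decr a b : 0 <= a < b -> Derive S b < Derive S a.
Proof.
  intros Hab.
  destruct (MVT_smooth (Derive S) a b) as (c & Hc & Hin);
    [now apply smooth_Derive|lra|].
  pose proof (sigmoidal_Derive2_neg c ltac:(lra)) as Hn.
  change (Derive_n S 2 c) with (Derive (Derive S) c) in Hn. nra.
Qed.

(** The slope is even and decreases away from the origin, where it equals 1. *)
Lemma sigmoidal_Derive_lt_1 x : x <> 0 -> Derive S x < 1.
Proof.
  intros Hx. rewrite <- (sig_slope S hS). change (Derive_n S 1 0) with (Derive S 0).
  destruct (Rtotal_order x 0) as [Hl|[He|Hg]]; [|lra|].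
  - rewrite <- sigmoidal_Derive_even. apply sigmoidal_Derive_decr. lra.
  - apply sigmoidal_Derive_decr. lra.
Qed.

Lemma sigmoidal_lt_id x : 0 < x -> S x < x.
Proof.
  intros Hx. destruct (MVT_smooth S 0 x hsm Hx) as (c & Hc & Hin).
  rewrite sigmoidal_0 in Hc. pose proof (sigmoidal_Derive_lt_1 c ltac:(lra)). nra.
Qed.

(** * Factorizations of [x - S x] and of the bump *)

(** The difference vanishes to third order at 0, because there [S] and its second derivative are 0
    and its slope is 1. Away from 0 the sign of [c] comes from [S x < x] for positive [x] and from
    oddness. *)
Lemma sigmoidal_cubic_factor :
  exists c, smooth c /\ (forall x, 0 < c x) /\ forall x, x - S x = x ^ 3 * c x.
Proof.
  set (f x := x - S x).
  assert (Hf : smooth f) by (apply smooth_minus; [apply smooth_id|exact hsm]).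
  assert (D1 : forall x, Derive f x = 1 - Derive S x).
  { intros x. apply is_derive_unique.
    apply (is_derive_minus (fun z => z) S x 1 (Derive S x));
      [apply @is_derive_id|now apply smooth_is_derive]. }
  assert (D2 : forall n x, Derive_n f (n + 2) x = - Derive_n S (n + 2) x).
  { intros n x.
    rewrite <- (Derive_n_comp f n 2), <- (Derive_n_comp S n 2), <- Derive_n_opp.
    apply Derive_n_ext. clear x. intros x.
    change (Derive (Derive f) x = - Derive (Derive S) x).
    rewrite (Derive_ext _ _ x D1).
    apply is_derive_unique.
    replace (- Derive (Derive S) x) with (0 - Derive (Derive S) x) by ring.
    apply (is_derive_minus (fun _ => 1) (Derive S) x 0); [apply @is_derive_const|].
    apply smooth_is_derive. now apply smooth_Derive. }
  destruct (smooth_factor 3 f Hf) as (c & Hc & Hfc & Hc0).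
  { intros [|[|[|k]]] Hk; [| | |lia].
    - simpl. unfold f. rewrite sigmoidal_0. ring.
    - change (Derive f 0 = 0). rewrite D1. pose proof (sig_slope S hS) as H.
      change (Derive S 0 = 1) in H. lra.
    - rewrite (D2 0%nat). simpl Nat.add. rewrite sigmoidal_Derive2_0. ring. }
  assert (Hne : forall x, x <> 0 -> 0 < c x).
  { intros x Hx. specialize (Hfc x). unfold f in Hfc.
    destruct (Rtotal_order x 0) as [Hl|[He|Hg]]; [|lra|].
    - pose proof (sigmoidal_lt_id (- x) ltac:(lra)) as H. rewrite (sig_odd S hS) in H.
      assert (0 < (- x) ^ 3) by (apply pow_lt; lra). simpl in *. nra.
    - pose proof (sigmoidal_lt_id x Hg) as H.
      assert (0 < x ^ 3) by (apply pow_lt; lra). simpl in *. nra. }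
  exists c. split; [exact Hc|]. split; [|exact Hfc].
  intros x. destruct (Req_dec x 0) as [->|Hx]; [|now apply Hne].
  (* At the origin [c 0] is minus the third derivative of [S] divided by 6. The hypotheses give only
     that this is nonzero; continuity of [c] settles the sign. *)
  assert (Hge : 0 <= c 0).
  { apply continuity_pt_nonneg; [now apply smooth_continuity_pt|exact Hne]. }
  assert (c 0 <> 0); [|lra].
  rewrite Hc0, (D2 1%nat). pose proof (sig_odd_derivatives S hS 1) as H3.
  change (2 * 1 + 1)%nat with (1 + 2)%nat in H3.
  unfold Rdiv. apply Rmult_integral_contrapositive_currified; [lra|].
  apply Rinv_neq_0_compat, INR_fact_neq_0.
Qed.

(** The negated bump [f] is even and vanishes at 0 together with its slope, so [u ^ 2] splits off.
    It is positive for [u > 0] because it increases there, and for [u < 0] by evenness. At the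
    origin [b 0] is half its second derivative, that is, minus the second derivative of [S] at
    [delta]. *)
Lemma bump_quadratic_factor delta :
  0 < delta ->
  exists b, smooth b /\ (forall u, 0 < b u) /\
    forall u, bump S delta u = - (u ^ 2 * b u).
Proof.
  intros Hd.
  (* Writing [u + - delta] makes both terms instances of [smooth_shift]. *)
  set (f u := 2 * S delta - (S (u + delta) - S (u + - delta))).
  assert (Hf : smooth f).
  { apply smooth_minus; [apply smooth_const|].
    apply smooth_minus; now apply smooth_shift. }
  assert (Hs : forall k e x,
    is_derive (fun u => Derive_n S k (u + e)) x (Derive_n S (1 + k) (x + e))).
  { intros k e x. change (Derive_n S (1 + k)) with (Derive (Derive_n S k)).
    replace (Derive (Derive_n S k) (x + e)) with
      (Derive (fun u => Derive_n S k (u + e)) x)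
      by apply (Derive_n_comp_trans (Derive_n S k) 1 x e).
    apply smooth_is_derive, smooth_shift. now apply smooth_Derive_n. }
  assert (D1 : forall x, Derive f x = Derive S (x + - delta) - Derive S (x + delta)).
  { intros x. apply is_derive_unique.
    replace (Derive S (x + - delta) - Derive S (x + delta)) with
      (0 - (Derive S (x + delta) - Derive S (x + - delta))) by ring.
    apply (is_derive_minus (fun _ => 2 * S delta)
      (fun u => S (u + delta) - S (u + - delta)) x 0); [apply @is_derive_const|].
    apply (is_derive_minus (fun u => S (u + delta)) (fun u => S (u + - delta)));
      apply (Hs 0%nat). }
  assert (D2 : Derive_n f 2 0 = - 2 * Derive_n S 2 delta).
  { change (Derive (Derive f) 0 = - 2 * Derive_n S 2 delta).
    rewrite (Derive_ext _ _ 0 D1).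
    replace (- 2 * Derive_n S 2 delta) with
      (Derive_n S 2 (0 + - delta) - Derive_n S 2 (0 + delta)).
    - apply is_derive_unique.
      apply (is_derive_minus (fun u => Derive S (u + - delta))
        (fun u => Derive S (u + delta))); apply (Hs 1%nat).
    - rewrite !Rplus_0_l, sigmoidal_Derive_n_opp. simpl. ring. }
  assert (H0 : f 0 = 0).
  { unfold f. rewrite !Rplus_0_l, (sig_odd S hS). ring. }
  destruct (smooth_factor 2 f Hf) as (b & Hb & Hfb & Hb0).
  { intros [|[|k]] Hk; [exact H0| |lia].
    change (Derive f 0 = 0). rewrite D1, !Rplus_0_l, sigmoidal_Derive_even. ring. }
  assert (Hpos : forall u, 0 < u -> 0 < f u).
  { intros u Hu. destruct (MVT_smooth f 0 u Hf Hu) as (x & Hx & Hin).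
    rewrite H0, D1 in Hx.
    assert (Derive S (x + delta) < Derive S (x + - delta)); [|nra].
    (* Since [x] and [delta] are positive, [x + delta] exceeds the absolute value of [x - delta].
       When [x < delta], evenness of the slope replaces [x - delta] by its opposite. *)
    destruct (Rle_or_lt delta x).
    - apply sigmoidal_Derive_decr. lra.
    - rewrite <- (sigmoidal_Derive_even (x + - delta)).
      apply sigmoidal_Derive_decr. lra. }
  assert (Heven : forall u, f (- u) = f u).
  { intros u. unfold f.
    replace (- u + delta) with (- (u + - delta)) by ring.
    replace (- u + - delta) with (- (u + delta)) by ring.
    rewrite !(sig_odd S hS). ring. }
  exists b. split; [exact Hb|]. split.
  - intros u. destruct (Rtotal_order u 0) as [Hl|[->|Hg]].
    + pose proof (Hpos (- u) ltac:(lra)) as H. rewrite Heven, Hfb in H.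
      assert (0 < u ^ 2) by nra. nra.
    + rewrite Hb0, D2. pose proof (sigmoidal_Derive2_neg delta Hd).
      replace (INR (fact 2)) with 2 by (simpl; ring). lra.
    + pose proof (Hpos u Hg) as H. rewrite Hfb in H.
      assert (0 < u ^ 2) by nra. nra.
  - intros u. rewrite <- Hfb. unfold f, bump, Rminus. ring.
Qed.

End Sigmoidal.

(** * The change of coordinates *)

Lemma Rpower_third_cube x a : 0 < x -> Rpower x (a / 3) ^ 3 = Rpower x a.
Proof.
  intros Hx. rewrite <- Rpower_pow by apply exp_pos.
  rewrite Rpower_mult. f_equal. simpl. field.
Qed.

(** The function is the real cube root of [x - S x], written so as to be smooth through the origin.
    Away from 0 its cube has positive slope [1 - Derive S w], which forces [l > 0]. *)
Lemma sigmoidal_cubic_root_increasing S c w :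
  sigmoidal S -> smooth c -> (forall x, 0 < c x) ->
  (forall x, x - S x = x ^ 3 * c x) ->
  exists l, is_derive (fun x => x * Rpower (c x) (1 / 3)) w l /\ 0 < l.
Proof.
  intros hS Hc Hpos HSc.
  set (r x := Rpower (c x) (1 / 3)).
  assert (Hr : ex_derive r w).
  { eexists. apply (is_derive_comp (fun z => Rpower z (1 / 3)) c).
    - now apply is_derive_Rpower.
    - now apply smooth_is_derive. }
  assert (Hrw : 0 < r w) by apply exp_pos.
  set (l := r w + w * Derive r w).
  assert (Hl : is_derive (fun x => x * r x) w l).
  { auto_derive; [tauto|]. unfold l.
    change (Derive (fun y => r y)) with (Derive r). ring. }
  exists l. split; [exact Hl|].
  (* At the origin the slope of the cube is 0 and gives no information, but there [l] reduces to
     [r 0]. *)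
  destruct (Req_dec w 0) as [->|Hw].
  { unfold l. rewrite Rmult_0_l. lra. }
  (* Both sides are the derivative of the cube: by the power rule, and through the identity
     [(x * r x) ^ 3 = x - S x]. *)
  assert (E : 3 * (w * r w) ^ 2 * l = 1 - Derive S w).
  { transitivity (Derive (fun x => (x * r x) ^ 3) w).
    - symmetry. apply is_derive_unique.
      replace (3 * (w * r w) ^ 2 * l) with (INR 3 * l * (w * r w) ^ 2)
        by (simpl; ring).
      apply (is_derive_pow (fun x => x * r x) 3 w l Hl).
    - rewrite (Derive_ext _ (fun x => x - S x)).
      + apply is_derive_unique.
        apply (is_derive_minus (fun z => z) S w 1 (Derive S w));
          [apply @is_derive_id|apply smooth_is_derive, (sig_smooth S hS)].
      + intros x. rewrite Rpow_mult_distr, HSc. f_equal. unfold r.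
        rewrite Rpower_third_cube by apply Hpos. now apply Rpower_1. }
  pose proof (sigmoidal_Derive_lt_1 S hS w Hw) as Hlt.
  assert (0 < (w * r w) ^ 2); [|nra].
  apply pow2_gt_0. apply Rmult_integral_contrapositive_currified; lra.
Qed.

Theorem proposition3 (S : R -> R) (hS : sigmoidal S) :
  exists delta0 : R, 0 < delta0 /\
    forall delta : R, 0 < delta < delta0 ->
      (forall y u : R,
         interconnection S delta 0 0 0 y u = - y + S (bump S delta u + y)) /\
      strongly_equivalent (fun y u : R => - y + S (bump S delta u + y)) g_wcusp.
Proof.
  (* The value 1 is an arbitrary positive choice. *)
  exists 1. split; [lra|]. intros delta [Hd _]. split.
  { intros y u. unfold interconnection. f_equal.
    replace (u + 0 * y / 2) with u by field. f_equal. ring. }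
  destruct (sigmoidal_cubic_factor S hS) as (c & Hc & Hcpos & HSc).
  destruct (bump_quadratic_factor S hS delta Hd) as (b & Hb & Hbpos & HB).
  (* Subtraction and powers are spelled out with sums and products so that the term matches the
     constructors of [smooth_expr]; the two mappings below are rewritten for the same reason. *)
  set (w y u := y + -1 * (u * u * b u)).
  assert (Hw : smooth_expr w).
  { repeat constructor. exact Hb. }
  assert (HwB : forall y u, bump S delta u + y = w y u).
  { intros y u. rewrite HB. unfold w. ring. }
  split.
  { replace (fun y u => - y + S (bump S delta u + y)) with
      (fun y u => -1 * y + S (w y u)).
    - apply smooth_expr_smooth2.
      apply (expr_plus (fun y _ => -1 * y)); [repeat constructor|].
      apply expr_comp; [apply (sig_smooth S hS)|exact Hw].
    - extensionality y. extensionality u. rewrite HwB. ring. }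
  split.
  { replace g_wcusp with (fun y u => -1 * (y * (y * y)) + -1 * (u * u)).
    - apply smooth_expr_smooth2. repeat constructor.
    - extensionality y. extensionality u. unfold g_wcusp. ring. }
  (* The cube of this [Y] is [w ^ 3 * c w / b], so multiplying [- Y ^ 3 - u ^ 2] by [b] gives
     [(S w - w) + bump], which is [S w - y]. *)
  exists (fun y u => w y u * Rpower (c (w y u)) (1 / 3) * Rpower (b u) (-1 / 3)),
    (fun _ u => b u).
  split; [|split; [|split; [|split; [|split; [|split; [|split; [|split]]]]]]].
  - apply smooth_expr_smooth2. repeat constructor; auto; now apply smooth_expr_comp1.
  - apply smooth_id.
  - apply smooth_expr_smooth2. now apply smooth_expr_comp1.
  - unfold w. ring.
  - reflexivity.
  - intros y u.
    (* For fixed [u], [w] has slope 1 in [y], so the slope of [Y] is that of the cube root at [w]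
       times the positive constant [Rpower (b u) (-1 / 3)]. *)
    destruct (sigmoidal_cubic_root_increasing S c (w y u) hS Hc Hcpos HSc)
      as (l & Hl & Hlpos).
    rewrite (is_derive_unique _ y (Rpower (b u) (-1 / 3) * l)).
    + apply Rmult_lt_0_compat; [apply exp_pos|exact Hlpos].
    + apply (is_derive_ext (fun z => Rpower (b u) (-1 / 3) *
        (w z u * Rpower (c (w z u)) (1 / 3)))); [intros; simpl; ring|].
      apply is_derive_scal.
      rewrite <- (Rmult_1_l l).
      apply (is_derive_comp (fun x => x * Rpower (c x) (1 / 3)) (fun z => w z u));
        [exact Hl|].
      unfold w. auto_derive; [exact I|ring].
  - intros u. rewrite Derive_id. lra.
  - intros y u. apply Hbpos.
  - apply locally_2d_forall. intros y u. unfold g_wcusp.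
    rewrite !Rpow_mult_distr, !Rpower_third_cube by auto.
    rewrite Rpower_1 by auto.
    change (-1) with (- (1)). rewrite Rpower_Ropp, Rpower_1 by auto.
    rewrite HwB. pose proof (HSc (w y u)) as E.
    replace (S (w y u)) with (w y u - w y u ^ 3 * c (w y u)) by lra.
    (* Only the linear occurrence of [w] has to be expanded; the cubic terms cancel as they
       stand. *)
    unfold w at 1. pose proof (Hbpos u). field. lra.
Qed.
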